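(* Let $d\in D$. Let $a\in\mathrm{Nuc}((D,\delta,d))^\times\subset D^\times$ and $G_a\in\mathrm{Aut}_F((D,\delta,d))$, where $G_a(h)=(a^{-1}h)a$. Then $$G_a=H_{i_a,\,a^{-1}\delta(a)},$$ and $\{H_{i_a,a^{-1}\delta(a)}\mid a\in\mathrm{Nuc}((D,\delta,d))^\times\}$ is a subgroup of $\mathrm{Aut}_F((D,\delta,d))$ of inner automorphisms. In particular, $\{a^{-1}\delta(a)\mid a\in C\cap\mathrm{Nuc}((D,\delta,d))^\times\}$ (identified with a set of automorphisms via $c\mapsto H_{\mathrm{id},c}$) is a subgroup of $\{H_{i_a,a^{-1}\delta(a)}\mid a\in\mathrm{Nuc}((D,\delta,d))^\times\}$.
   Context: $p$ is a prime, $C$ is a field of characteristic $p$, and $D$ is a finite-dimensional division algebra with center $C$ ($D=C$ is allowed). $\delta:D\to D$ is a derivation, i.e. additive with $\delta(ab)=a\delta(b)+\delta(a)b$; $\mathrm{Const}(\delta)=\{a\in D\mid\delta(a)=0\}$ and $F=C\cap\mathrm{Const}(\delta)$. It is assumed that $F$ is strictly contained in $C$ and that $\delta|_C$ is algebraic with minimum polynomial $g(t)=t^{p^e}+a_1t^{p^{e-1}}+\dots+a_et\in\mathrm{Const}(\delta)[t]$ of degree $p^e$. $R=D[t;\delta]$ is the differential polynomial ring: polynomials with left coefficients in $D$, multiplication determined by $ta=at+\delta(a)$. For monic $f\in R$ of degree $m$, every $h\in R$ can be written uniquely as $h=qf+r$ with $\deg r<m$; write $r=h\bmod_r f$. $R/Rf$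 is the set of polynomials of degree $<m$ with the usual addition and multiplication $g\circ h=gh\bmod_r f$, a unital, in general nonassociative, $F$-algebra. For $f(t)=g(t)-d$ it is denoted $(D,\delta,d)$; $\mathrm{Aut}_F((D,\delta,d))$ is its group of $F$-algebra automorphisms. For a nonassociative algebra $A$ with associator $[x,y,z]=(xy)z-x(yz)$, $\mathrm{Nuc}(A)=\{x\in A\mid[x,A,A]=[A,x,A]=[A,A,x]=0\}$, an associative subalgebra; $\mathrm{Nuc}(A)^\times$ is its set of invertible elements. An automorphism of $A$ is called inner if it has the form $x\mapsto(a_lx)a$ for some $a\in A$ with a left inverse $a_l$. For $a\in D^\times$, $i_a:D\to D$ is $i_a(x)=a^{-1}xa$. For $\tau\in\mathrm{Aut}(D)$ (the automorphism group of $D$) and $c\in D$, $H_{\tau,c}$ denotes the map $\sum_{i=0}^{p^e-1}b_it^i\mapsto\sum_{i=0}^{p^e-1}\tau(b_i)(t+c)^i$ on $(D,\delta,d)$.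
   Formalization: The inclusion of the nuclear units in D^× fails when (D,δ,d) is associative (e.g. 1+t for g=t^p, d=0), where H is undefined for a outside D; so a ranges over nuclear units lying in D, and the inclusion is proved when (D,δ,d) is not associative. *)

(* Defs.v *)
From HB Require Import structures.
From mathcomp Require Import all_boot all_order all_algebra all_field.

Set Implicit Arguments.
Unset Strict Implicit.
Unset Printing Implicit Defensive.

Import GRing.Theory.
Local Open Scope ring_scope.

Record derivation (D : nzRingType) := Derivation {
  der_fun :> {additive D -> D};
  _ : forall a b : D, der_fun (a * b) = a * der_fun b + der_fun a * b
}.

(* D[t; delta]: dpoly is the underlying polynomial, with left coefficients; the
   parameter delta only serves to select the multiplication. *)
Record diffpoly (D : nzRingType) (delta : derivation D) :=
  DiffPoly { dpoly :> {poly D} }.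

Section DiffPoly.
Variables (D : nzRingType) (delta : derivation D).

Lemma derM (a b : D) : delta (a * b) = a * delta b + delta a * b.
Proof. by case: delta. Qed.

Lemma der1 : delta 1 = 0.
Proof.
by have /eqP := derM 1 1; rewrite !mulr1 mul1r -subr_eq0 opprD addNKr oppr_eq0 => /eqP.
Qed.

Implicit Types p q r : {poly D}.

(* Left multiplication by t, from t * b = b * t + delta b on coefficients. *)
Definition diff_mulX p : {poly D} := p * 'X + map_poly delta p.

Definition diff_mul p q : {poly D} :=
  \sum_(i < size p) p`_i *: iter i diff_mulX q.

Lemma diff_mulXD : {morph diff_mulX : p q / p + q}.
Proof. by move=> p q; rewrite /diff_mulX mulrDl raddfD addrACA. Qed.

Lemma diff_mulX0 : diff_mulX 0 = 0.
Proof. by rewrite /diff_mulX mul0r raddf0 addr0. Qed.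

Lemma diff_mulXZ (a : D) p :
  diff_mulX (a *: p) = a *: diff_mulX p + delta a *: p.
Proof.
rewrite /diff_mulX -scalerAl scalerDr -!addrA; congr (_ + _).
by apply/polyP=> i; rewrite coefD !(coef_map, coefZ) /= derM.
Qed.

Lemma iter_diff_mulXD n (p q : {poly D}) :
  iter n diff_mulX (p + q) = iter n diff_mulX p + iter n diff_mulX q.
Proof. by elim: n => //= n ->; rewrite diff_mulXD. Qed.

Lemma iter_diff_mulX0 n : iter n diff_mulX 0 = 0.
Proof. by elim: n => //= n ->; rewrite diff_mulX0. Qed.

Lemma diff_mulE n p q : (size p <= n)%N ->
  diff_mul p q = \sum_(i < n) p`_i *: iter i diff_mulX q.
Proof.
move=> le_pn; rewrite /diff_mul.
rewrite (big_ord_widen _ (fun i => p`_i *: iter i diff_mulX q) le_pn).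
rewrite big_mkcond; apply: eq_bigr => i _; case: ltnP => // /leq_sizeP->//.
by rewrite scale0r.
Qed.

Lemma diff_mulDl : left_distributive diff_mul +%R.
Proof.
move=> p q r; set n := maxn (size p) (size q).
rewrite (@diff_mulE n (p + q)) ?(leq_trans (size_polyD _ _)) //.
rewrite (@diff_mulE n p) ?leq_maxl // (@diff_mulE n q) ?leq_maxr //.
by rewrite -big_split; apply: eq_bigr => i _; rewrite coefD scalerDl.
Qed.

Lemma diff_mulDr : right_distributive diff_mul +%R.
Proof.
move=> p q r; rewrite /diff_mul -big_split; apply: eq_bigr => i _.
by rewrite iter_diff_mulXD scalerDr.
Qed.

Lemma diff_mulZl (a : D) p q : diff_mul (a *: p) q = a *: diff_mul p q.
Proof.
rewrite (@diff_mulE (size p) (a *: p)) ?size_scale_leq //.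
by rewrite /diff_mul scaler_sumr; apply: eq_bigr => i _; rewrite coefZ scalerA.
Qed.

Lemma diff_mul0l q : diff_mul 0 q = 0.
Proof. by rewrite /diff_mul size_poly0 big_ord0. Qed.

Lemma diff_mulX_sum (I : Type) (s : seq I) (P : pred I) (F : I -> {poly D}) :
  diff_mulX (\sum_(i <- s | P i) F i) = \sum_(i <- s | P i) diff_mulX (F i).
Proof. by apply: (big_morph _ diff_mulXD diff_mulX0). Qed.

Lemma diff_mul_suml (I : Type) (s : seq I) (P : pred I) (F : I -> {poly D}) q :
  diff_mul (\sum_(i <- s | P i) F i) q = \sum_(i <- s | P i) diff_mul (F i) q.
Proof. by apply: (big_morph (diff_mul^~ q)) => [p r|]; rewrite ?diff_mulDl ?diff_mul0l. Qed.

Lemma diff_mulXl p q : diff_mul (diff_mulX p) q = diff_mulX (diff_mul p q).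
Proof.
rewrite {1}/diff_mulX diff_mulDl /diff_mul diff_mulX_sum.
rewrite -!/(diff_mul _ _); set n := size p.
rewrite (@diff_mulE n.+1 (p * 'X : {poly D})); last first.
  by rewrite (leq_trans (size_polyMleq _ _)) // size_polyX addn2.
rewrite (@diff_mulE n (map_poly delta p)); last exact: size_poly.
rewrite big_ord_recl coefMX /= scale0r add0r -big_split; apply: eq_bigr => i _.
by rewrite diff_mulXZ coefMX /= coef_map.
Qed.

Lemma diff_mulA : associative diff_mul.
Proof.
move=> p q r; rewrite {1}/diff_mul [in RHS]/(diff_mul p q) diff_mul_suml; apply: eq_bigr => i _.
rewrite diff_mulZl; congr (_ *: _).
by elim: {i} (i : nat) => //= n ->; rewrite diff_mulXl.
Qed.

Lemma diff_mul1l : left_id (1 : {poly D}) diff_mul.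
Proof. by move=> p; rewrite /diff_mul size_poly1 big_ord1 coef1 scale1r. Qed.

Lemma iter_diff_mulX1 n : iter n diff_mulX 1 = 'X^n.
Proof.
elim: n => //= n ->; rewrite /diff_mulX -exprSr; apply/polyP=> i.
rewrite coefD coef_map /= !coefXn; case: (i == n); last by rewrite raddf0 addr0.
by rewrite /= der1 addr0.
Qed.

Lemma diff_mul1r : right_id (1 : {poly D}) diff_mul.
Proof.
move=> p; rewrite /diff_mul [RHS](esym (coefK _)) poly_def.
by apply: eq_bigr => i _; rewrite iter_diff_mulX1.
Qed.


Local Notation diffpoly := (diffpoly delta).
Local Notation DiffPoly := (@DiffPoly D delta).
Local Notation dpoly := (@dpoly D delta).

HB.instance Definition _ := [isNew for dpoly].
HB.instance Definition _ := [Choice of diffpoly by <:].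

Lemma dpoly_inj : injective dpoly.
Proof. exact: val_inj. Qed.

Definition dp_add (p q : diffpoly) := DiffPoly (dpoly p + dpoly q).
Definition dp_opp (p : diffpoly) := DiffPoly (- dpoly p).
Definition dp_mul (p q : diffpoly) := DiffPoly (diff_mul p q).
Definition dp_scale (a : D) (p : diffpoly) := DiffPoly (a *: dpoly p).

Fact dp_addA : associative dp_add.
Proof. by move=> p q r; apply: dpoly_inj; rewrite /= addrA. Qed.
Fact dp_addC : commutative dp_add.
Proof. by move=> p q; apply: dpoly_inj; rewrite /= addrC. Qed.
Fact dp_add0 : left_id (DiffPoly 0) dp_add.
Proof. by move=> p; apply: dpoly_inj; rewrite /= add0r. Qed.
Fact dp_addN : left_inverse (DiffPoly 0) dp_opp dp_add.
Proof. by move=> p; apply: dpoly_inj; rewrite /= addNr. Qed.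
HB.instance Definition _ :=
  GRing.isZmodule.Build diffpoly dp_addA dp_addC dp_add0 dp_addN.

Fact dp_mulA : associative dp_mul.
Proof. by move=> p q r; apply: dpoly_inj; rewrite /= diff_mulA. Qed.
Fact dp_mul1l : left_id (DiffPoly 1) dp_mul.
Proof. by move=> p; apply: dpoly_inj; rewrite /= diff_mul1l. Qed.
Fact dp_mul1r : right_id (DiffPoly 1) dp_mul.
Proof. by move=> p; apply: dpoly_inj; rewrite /= diff_mul1r. Qed.
Fact dp_mulDl : left_distributive dp_mul +%R.
Proof. by move=> p q r; apply: dpoly_inj; rewrite /= diff_mulDl. Qed.
Fact dp_mulDr : right_distributive dp_mul +%R.
Proof. by move=> p q r; apply: dpoly_inj; rewrite /= diff_mulDr. Qed.
Fact dp_oner_neq0 : DiffPoly 1 != 0.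
Proof. by apply/eqP=> /(congr1 dpoly)/eqP; rewrite /= oner_eq0. Qed.
HB.instance Definition _ := GRing.Zmodule_isNzRing.Build diffpoly
  dp_mulA dp_mul1l dp_mul1r dp_mulDl dp_mulDr dp_oner_neq0.

Fact dp_scaleA a b (p : diffpoly) :
  dp_scale a (dp_scale b p) = dp_scale (a * b) p.
Proof. by apply: dpoly_inj; rewrite /= scalerA. Qed.
Fact dp_scale1 : left_id 1 dp_scale.
Proof. by move=> p; apply: dpoly_inj; rewrite /= scale1r. Qed.
Fact dp_scaleDr : right_distributive dp_scale +%R.
Proof. by move=> a p q; apply: dpoly_inj; rewrite /= scalerDr. Qed.
Fact dp_scaleDl (p : diffpoly) : {morph dp_scale^~ p : a b / a + b}.
Proof. by move=> a b; apply: dpoly_inj; rewrite /= scalerDl. Qed.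
HB.instance Definition _ := GRing.Zmodule_isLmodule.Build D diffpoly
  dp_scaleA dp_scale1 dp_scaleDr dp_scaleDl.

Fact dp_scaleAl a (p q : diffpoly) : a *: (p * q) = (a *: p) * q.
Proof. by apply: dpoly_inj; rewrite /= diff_mulZl. Qed.
HB.instance Definition _ := GRing.Lmodule_isLalgebra.Build D diffpoly
  dp_scaleAl.

Fact dpoly_is_linear : linear dpoly.
Proof. by []. Qed.
HB.instance Definition _ := GRing.isLinear.Build D diffpoly {poly D} _ dpoly
  dpoly_is_linear.

Lemma dpolyD (p q : diffpoly) : dpoly (p + q) = dpoly p + dpoly q.
Proof. by []. Qed.

Lemma dpolyZ (a : D) (p : diffpoly) : dpoly (a *: p) = a *: dpoly p.
Proof. by []. Qed.

Definition dvar : diffpoly := DiffPoly 'X.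

(* a *: 1 is the constant a. *)
Lemma dpoly_alg (a : D) : dpoly a%:A = a%:P.
Proof. by rewrite linearZ /= -alg_polyC. Qed.

Lemma dpolyXM (p : diffpoly) : dpoly (dvar * p) = diff_mulX p.
Proof.
rewrite /= /diff_mul size_polyX !big_ord_recl big_ord0.
by rewrite !coefX /= scale0r add0r addr0 scale1r.
Qed.

Lemma dvar_comm (a : D) : dvar * a%:A = a%:A * dvar + (delta a)%:A.
Proof.
apply: dpoly_inj; rewrite dpolyXM mulr_algl dpoly_alg dpolyD dpolyZ.
rewrite [dpoly (delta a)%:A]dpoly_alg.
by rewrite /diff_mulX map_polyC mul_polyC.
Qed.

Lemma dpolyE (p : diffpoly) : p = \sum_(i < size p) p`_i *: dvar ^+ i.
Proof.
have dvarXn i : dpoly (dvar ^+ i) = 'X^i.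
  elim: i => // i IHi; rewrite exprS dpolyXM IHi -[RHS]iter_diff_mulX1 /=.
  by rewrite iter_diff_mulX1.
apply: dpoly_inj; rewrite raddf_sum -[LHS]coefK poly_def.
by apply: eq_bigr => i _; rewrite -dvarXn.
Qed.

(* Remainder of the division h = q * f + r by a monic f. *)
Fixpoint dmod_rec (n : nat) (f h : diffpoly) : diffpoly :=
  if (size h < size f)%N then h else
  if n is n'.+1 then
    dmod_rec n' f (h - lead_coef h *: (dvar ^+ (size h - size f) * f))
  else h.
Definition dmod (f h : diffpoly) : diffpoly := dmod_rec (size h) f h.

Lemma size_lead_diff_mulX p : p != 0 ->
  size (diff_mulX p) = (size p).+1 /\ lead_coef (diff_mulX p) = lead_coef p.
Proof.
move=> nz_p; have lt_s : (size (map_poly delta p) < size (p * 'X)%R)%N.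
  by rewrite size_mulX // ltnS size_poly.
by rewrite /diff_mulX size_polyDl // lead_coefDl // size_mulX // lead_coefMX.
Qed.

Lemma size_lead_dvarXnM n (f : diffpoly) : dpoly f != 0 ->
  size (dvar ^+ n * f) = (n + size f)%N
  /\ lead_coef (dvar ^+ n * f) = lead_coef f.
Proof.
move=> nz_f; elim: n => [|n [IHs IHl]]; first by rewrite expr0 mul1r.
have nz_h : dpoly (dvar ^+ n * f) != 0.
  by rewrite -size_poly_gt0 IHs addn_gt0 size_poly_gt0 nz_f orbT.
rewrite exprS -mulrA dpolyXM.
by have [-> ->] := size_lead_diff_mulX nz_h; rewrite IHs IHl.
Qed.

Lemma dpolyM_sum (p q : diffpoly) :
  dpoly (p * q) = \sum_(i < size p) p`_i *: dpoly (dvar ^+ i * q).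
Proof.
rewrite {1}[p]dpolyE mulr_suml raddf_sum; apply: eq_bigr => i _.
by rewrite -scalerAl.
Qed.

Lemma size_diff_mul (p f : diffpoly) : dpoly f \is monic -> dpoly p != 0 ->
  size (p * f) = (size p + size f).-1.
Proof.
move=> mon_f nz_p; rewrite dpolyM_sum.
have nz_f := monic_neq0 mon_f.
have f_gt0 : (0 < size f)%N by rewrite size_poly_gt0.
case Ds: (size p) => [|n]; first by move: nz_p; rewrite -size_poly_eq0 Ds.
have lc_p : p`_n != 0 by rewrite -[n]/(n.+1.-1) -Ds -lead_coefE lead_coef_eq0.
have [sz_n lc_n] := size_lead_dvarXnM n nz_f.
have sz_top : size (p`_n *: dpoly (dvar ^+ n * f)) = (n + size f)%N.
  apply/eqP; rewrite eqn_leq -{1}sz_n size_scale_leq /= leqNgt; apply/negP.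
  have Dm : (n + size f = (n + size f).-1.+1)%N.
    by rewrite prednK // addn_gt0 f_gt0 orbT.
  rewrite Dm ltnS => /leq_sizeP/(_ _ (leqnn _))/eqP.
  rewrite coefZ -{1}sz_n -lead_coefE lc_n (monicP mon_f) mulr1.
  exact/negP.
rewrite big_ord_recr /= addrC size_polyDl sz_top //.
have -> : (n + size f = (n + size f).-1.+1)%N.
  by rewrite prednK // addn_gt0 f_gt0 orbT.
rewrite ltnS; apply: (leq_trans (size_sum _ _ _)).
apply/bigmax_leqP => i _; apply: (leq_trans (size_scale_leq _ _)).
have [-> _] := size_lead_dvarXnM i nz_f.
by rewrite -ltnS prednK ?addn_gt0 ?f_gt0 ?orbT // ltn_add2r.
Qed.

Lemma dmodP (f h : diffpoly) : dpoly f \is monic ->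
  (size (dmod f h) < size f)%N /\ exists q : diffpoly, h = q * f + dmod f h.
Proof.
move=> mon_f; have nz_f := monic_neq0 mon_f; rewrite /dmod.
suff H n : (size h <= n)%N -> (size (dmod_rec n f h) < size f)%N
    /\ exists q : diffpoly, h = q * f + dmod_rec n f h by exact: H.
elim: n h => [|n IHn] h le_hn /=.
  rewrite if_same; split; first by rewrite (leq_ltn_trans le_hn) ?size_poly_gt0.
  by exists 0; rewrite mul0r add0r.
have [lt_hf | le_fh] := ltnP (size h) (size f).
  by split=> //; exists 0; rewrite mul0r add0r.
set k := (_ - _)%N; set a := lead_coef _.
have [sz_k lc_k] := size_lead_dvarXnM k nz_f.
rewrite subnK // in sz_k; set h' := h - _.
have le_h'n : (size h' <= n)%N.
  apply/leq_sizeP => j le_nj.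
  have -> : dpoly h' = dpoly h - a *: dpoly (dvar ^+ k * f) by [].
  rewrite coefB coefZ.
  have [le_hj | lt_jh] := leqP (size h) j.
    by rewrite !nth_default ?sz_k // mulr0 subr0.
  have Dj : j = (size h).-1.
    have Ds : size h = j.+1.
      by apply/eqP; rewrite eqn_leq lt_jh andbT (leq_trans le_hn).
    by rewrite Ds.
  by rewrite Dj -{2}sz_k -!lead_coefE lc_k (monicP mon_f) mulr1 subrr.
have [lt_rf [q Dh']] := IHn h' le_h'n; split=> //.
exists (q + a *: dvar ^+ k).
by rewrite mulrDl -scalerAl addrAC -Dh' subrK.
Qed.

Lemma dmod_uniq (f q r : diffpoly) : dpoly f \is monic ->
  (size r < size f)%N -> dmod f (q * f + r) = r.
Proof.
move=> mon_f lt_rf; have [lt_r'f [q' Dh]] := dmodP (q * f + r) mon_f.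
set r' := dmod _ _ in lt_r'f Dh *.
have Dr : (q - q') * f = r' - r.
  by apply/eqP; rewrite mulrBl subr_eq addrAC eq_sym subr_eq addrC -Dh addrC.
have [qq' | nz_q] := eqVneq (dpoly (q - q')) 0.
  have q0 : q - q' = 0 by apply: dpoly_inj.
  by apply/eqP; rewrite -subr_eq0 -Dr q0 mul0r.
have: (size (r' - r)%R < size f)%N.
  rewrite (leq_ltn_trans (size_polyD r' (- dpoly r))) // gtn_max lt_r'f.
  by rewrite size_polyN.
rewrite -Dr size_diff_mul //; move: nz_q; rewrite -size_poly_gt0.
by case: (size (q - q')) => // n _; rewrite addSn /= ltnNge leq_addl.
Qed.

End DiffPoly.

Section NonassociativeAlgebra.
Variables (A : zmodType) (mul : A -> A -> A) (one : A).

Definition associator (x y z : A) : A := mul (mul x y) z - mul x (mul y z).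

Definition nucleus (x : A) : Prop := forall y z : A,
  [/\ associator x y z = 0, associator y x z = 0 & associator y z x = 0].

Definition nucleus_unit (x : A) : Prop :=
  nucleus x /\ exists2 y : A, nucleus y & mul x y = one /\ mul y x = one.

Definition inner_map (phi : A -> A) : Prop :=
  exists a al : A, mul al a = one /\ forall x : A, phi x = mul (mul al x) a.

End NonassociativeAlgebra.

Definition algebra_aut (D : nzRingType) (K : pred D) (A : lmodType D)
    (mul : A -> A -> A) (phi : A -> A) : Prop :=
  [/\ bijective phi, {morph phi : x y / x + y},
      forall (k : D) (x : A), k \in K -> phi (k *: x) = k *: phi x
    & {morph phi : x y / mul x y}].

(* S is a subgroup of G, for the composition of self-maps of T. *)
Definition map_subgroup (T : Type) (S G : (T -> T) -> Prop) : Prop :=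
  [/\ forall phi, S phi -> G phi,
      S id,
      forall phi psi, S phi -> S psi -> S (phi \o psi)
    & forall phi, S phi ->
        exists2 psi, S psi & cancel phi psi /\ cancel psi phi].

Section Petit.
Variables (D : nzRingType) (delta : derivation D) (f : diffpoly delta).

(* The algebra R/Rf for monic f: its elements are the polynomials of degree
   less than deg f = (size f).-1. *)
Definition petit : Type := {poly_((size f).-1) D}.
HB.instance Definition _ := GRing.Lmodule.copy petit {poly_((size f).-1) D}.

Definition petit_val (x : petit) : diffpoly delta :=
  DiffPoly delta (polyn (x : {poly_((size f).-1) D})).

Definition petit_mod (h : diffpoly delta) : petit := npolyp _ (dmod f h).

Lemma petit_modK (h : diffpoly delta) : dpoly f \is monic ->
  petit_val (petit_mod h) = dmod f h.
Proof.
move=> mon_f; have [lt_s _] := dmodP h mon_f.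
apply: dpoly_inj; rewrite /petit_val /= npolypK //.
by rewrite -ltnS prednK // size_poly_gt0 monic_neq0.
Qed.

Definition petit_mul (x y : petit) : petit :=
  petit_mod (petit_val x * petit_val y).

Definition petit_one : petit := petit_mod 1.

Definition petit_const (a : D) : petit := petit_mod a%:A.

Definition petit_H (tau : D -> D) (c : D) (x : petit) : petit :=
  petit_mod (\sum_(i < (size f).-1)
    tau (petit_val x)`_i *: (dvar delta + c%:A) ^+ i).

End Petit.

Section Differential.
Variables (C : fieldType) (D : falgType C) (delta : derivation D).

Definition constants : pred D := [pred a | delta a == 0].

(* C is identified with its image 1%VS in D. *)
Definition base_constants : pred D := [pred a | (a \in 1%VS) && (delta a == 0)].

Definition der_eval (h : {poly D}) (x : D) : D :=
  \sum_(i < size h) h`_i * iter i delta x.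

Definition min_poly_on_base (g : {poly D}) : Prop :=
  [/\ g \is monic, g \is a polyOver constants,
      forall x : D, x \in 1%VS -> der_eval g x = 0
    & forall h : {poly D}, h \is a polyOver constants -> h != 0 ->
        (forall x : D, x \in 1%VS -> der_eval h x = 0) -> (size g <= size h)%N].

Definition p_poly (p e : nat) (a : nat -> D) : {poly D} :=
  'X^(p ^ e) + \sum_(1 <= i < e.+1) a i *: 'X^(p ^ (e - i)).

Section Automorphisms.
Variable f : diffpoly delta.

Definition conj_by (a x : D) : D := a^-1 * x * a.

Definition petit_G (a : D) (x : petit f) : petit f :=
  petit_mul (petit_mul (petit_const f a^-1) x) (petit_const f a).

Definition petit_aut : (petit f -> petit f) -> Prop :=
  algebra_aut base_constants (@petit_mul D delta f).

Definition petit_nuc_unit : petit f -> Prop :=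
  nucleus_unit (@petit_mul D delta f) (petit_one f).

(* The invertible elements of the nucleus that lie in D, as they all do unless
   the algebra is associative. *)
Definition const_nuc_unit (a : D) : Prop :=
  a != 0 /\ petit_nuc_unit (petit_const f a).

Definition inner_H (phi : petit f -> petit f) : Prop :=
  exists2 a : D, const_nuc_unit a &
    phi =1 petit_H (conj_by a) (a^-1 * delta a).

Definition central_logder (c : D) : Prop :=
  exists a : D, [/\ a \in 1%VS, const_nuc_unit a & c = a^-1 * delta a].

Definition central_H (phi : petit f -> petit f) : Prop :=
  exists2 c : D, central_logder c & phi =1 petit_H id c.

End Automorphisms.
End Differential.

(* Main.v *)
(* Write m for the degree of f. If x y already has degree < m, then (x y) z = x (y z)
   in R/Rf; hence elements of D associate in the left and middle positions, and
   G_a is the restriction of the conjugation h |-> a^-1 h a of R = D[t; delta],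
   which sends t to t + a^-1 delta(a). Multiplicativity of G_a only needs a to
   lie in the right nucleus as well. Composition of the G_a is multiplication
   of the a, and m > 1 because delta is nonzero on C, so t lies in the algebra
   and H_{id,c}(t) = t + c determines c. *)
Require Import Defs.
From mathcomp Require Import all_boot all_order all_algebra all_field.

Set Implicit Arguments.
Unset Strict Implicit.
Unset Printing Implicit Defensive.

Import GRing.Theory.
Local Open Scope ring_scope.

Section Remainder.
Variables (D : nzRingType) (delta : derivation D) (f : diffpoly delta).
Hypothesis mon_f : dpoly f \is monic.
Implicit Types g h q : diffpoly delta.

Lemma dmod_small h : (size h < size f)%N -> dmod f h = h.
Proof. by move=> lt_hf; rewrite -[h in LHS]add0r -(mul0r f) dmod_uniq. Qed.

Lemma dmodMDl q h : dmod f (q * f + h) = dmod f h.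
Proof.
have [lt_rf [q' Dh]] := dmodP h mon_f.
by rewrite {1}Dh addrA -mulrDl dmod_uniq.
Qed.

Lemma dmodD g h : dmod f (g + h) = dmod f g + dmod f h.
Proof.
have [lt_gf [q Dg]] := dmodP g mon_f.
have [lt_hf [q' Dh]] := dmodP h mon_f.
rewrite {1}Dg {1}Dh addrACA -mulrDl dmodMDl dmod_small //.
by rewrite (leq_ltn_trans (size_polyD _ _)) // gtn_max lt_gf.
Qed.

Lemma dmodMr g h : dmod f (g * dmod f h) = dmod f (g * h).
Proof.
have [_ [q Dh]] := dmodP h mon_f.
by rewrite {2}Dh mulrDr mulrA dmodMDl.
Qed.

Lemma dmod0 : dmod f 0 = 0.
Proof. by rewrite -[LHS](addrK (dmod f 0)) -dmodD addr0 subrr. Qed.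

Lemma size_alg (a : D) : (size (dpoly (a%:A : diffpoly delta)) <= 1)%N.
Proof. by rewrite dpoly_alg size_polyC leq_b1. Qed.

Lemma algM (a b : D) : (a * b)%:A = a%:A * b%:A :> diffpoly delta.
Proof. by rewrite mulr_algl scalerA. Qed.

Lemma size_algM (a : D) h : (size (dpoly (a%:A * h)%R) <= size h)%N.
Proof. by rewrite mulr_algl dpolyZ size_scale_leq. Qed.

Lemma size_Malg (a : D) h : (size (dpoly (h * a%:A)%R) <= size h)%N.
Proof.
have [-> | nz_a] := eqVneq a 0; first by rewrite scale0r mulr0 size_poly0.
rewrite dpolyM_sum; apply: (leq_trans (size_sum _ _ _)).
apply/bigmax_leqP => i _; apply: (leq_trans (size_scale_leq _ _)).
have nz_A : dpoly (a%:A : diffpoly delta) != 0 by rewrite dpoly_alg polyC_eq0.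
have [-> _] := size_lead_dvarXnM i nz_A.
by rewrite dpoly_alg size_polyC nz_a addn1.
Qed.

End Remainder.

Section PetitAlgebra.
Variables (D : nzRingType) (delta : derivation D) (f : diffpoly delta).
Hypotheses (mon_f : dpoly f \is monic) (gt1_f : (1 < size f)%N).
Local Notation val := (@petit_val D delta f).
Local Notation mul := (@petit_mul D delta f).
Local Notation const := (@petit_const D delta f).
Local Notation one := (@petit_one D delta f).
Implicit Types x y z : petit f.

Lemma petit_val_inj : injective val.
Proof. by move=> x y /(congr1 (@dpoly _ _)) /= /val_inj. Qed.

Lemma size_petit_val x : (size (val x) < size f)%N.
Proof. by rewrite -(ltn_predK gt1_f) ltnS; case: x. Qed.

Lemma petit_valD x y : val (x + y) = val x + val y.
Proof. exact: dpoly_inj. Qed.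

Lemma petit_valZ (k : D) x : val (k *: x) = k *: val x.
Proof. exact: dpoly_inj. Qed.

Lemma petit_mod_small (h : diffpoly delta) : (size h < size f)%N -> val (petit_mod f h) = h.
Proof. by move=> lt_hf; rewrite petit_modK // dmod_small. Qed.

Lemma petit_val_const (a : D) : val (const a) = a%:A.
Proof. by rewrite petit_mod_small // (leq_ltn_trans (size_alg _ _)). Qed.

Lemma petit_oneE : one = const 1.
Proof. by rewrite /const scale1r. Qed.

Lemma petit_val_one : val one = 1.
Proof. by rewrite petit_oneE petit_val_const scale1r. Qed.

Lemma petit_val_mul x y : val (mul x y) = dmod f (val x * val y).
Proof. exact: petit_modK. Qed.

Lemma petit_val_constM (a : D) x : val (mul (const a) x) = a%:A * val x.
Proof.
rewrite petit_val_mul petit_val_const dmod_small //.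
exact: leq_ltn_trans (size_algM _ _) (size_petit_val x).
Qed.

Lemma petit_val_Mconst (a : D) x : val (mul x (const a)) = val x * a%:A.
Proof.
rewrite petit_val_mul petit_val_const dmod_small //.
exact: leq_ltn_trans (size_Malg _ _) (size_petit_val x).
Qed.

Lemma petit_constM (a b : D) : mul (const a) (const b) = const (a * b).
Proof.
apply: petit_val_inj.
by rewrite petit_val_constM !petit_val_const algM.
Qed.

Lemma petit_mulA_small x y z : (size (val x * val y)%R < size f)%N ->
  mul (mul x y) z = mul x (mul y z).
Proof.
move=> lt_xyf; apply: petit_val_inj.
by rewrite !petit_val_mul (dmod_small mon_f lt_xyf) dmodMr // mulrA.
Qed.

Lemma petit_constA (a : D) y z :
  mul (mul (const a) y) z = mul (const a) (mul y z).
Proof.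
apply: petit_mulA_small; rewrite petit_val_const.
exact: leq_ltn_trans (size_algM _ _) (size_petit_val y).
Qed.

Lemma petit_Aconst (a : D) x z :
  mul (mul x (const a)) z = mul x (mul (const a) z).
Proof.
apply: petit_mulA_small; rewrite petit_val_const.
exact: leq_ltn_trans (size_Malg _ _) (size_petit_val x).
Qed.

Lemma petit_mulA_normal :
  (forall z, dmod f (f * val z) = 0) -> associative mul.
Proof.
move=> fz0 x y z; apply: petit_val_inj; rewrite !petit_val_mul dmodMr // mulrA.
have [_ [q Dxy]] := dmodP (val x * val y) mon_f.
by rewrite {1}Dxy mulrDl -mulrA dmodD // -dmodMr // fz0 mulr0 dmod0 // add0r.
Qed.

End PetitAlgebra.

Section Nucleus.
Variables (A : zmodType) (mul : A -> A -> A) (one : A).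

Lemma associator_eq0 x y z :
  associator mul x y z = 0 <-> mul (mul x y) z = mul x (mul y z).
Proof. by split=> [/eqP|/eqP exyz]; [rewrite subr_eq0 => /eqP | apply/eqP; rewrite subr_eq0]. Qed.

Lemma nucleusP x :
  nucleus mul x <-> forall y z,
    [/\ mul (mul x y) z = mul x (mul y z),
        mul (mul y x) z = mul y (mul x z)
      & mul (mul y z) x = mul y (mul z x)].
Proof.
by split=> Nx y z; have [] := Nx y z; split; apply/associator_eq0.
Qed.

Lemma nucleusM x y : nucleus mul x -> nucleus mul y -> nucleus mul (mul x y).
Proof.
move=> /nucleusP Nx /nucleusP Ny; apply/nucleusP=> u v.
have xl w z : mul (mul x w) z = mul x (mul w z) by case: (Nx w z).
have xm w z : mul (mul w x) z = mul w (mul x z) by case: (Nx w z).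
have xr w z : mul (mul w z) x = mul w (mul z x) by case: (Nx w z).
have yl w z : mul (mul y w) z = mul y (mul w z) by case: (Ny w z).
have ym w z : mul (mul w y) z = mul w (mul y z) by case: (Ny w z).
have yr w z : mul (mul w z) y = mul w (mul z y) by case: (Ny w z).
split.
- by rewrite !xl yl.
- by rewrite -xm ym xm -xl.
by rewrite -!yr xr.
Qed.

End Nucleus.

Section DivisionAlgebra.
Variables (C : fieldType) (D : falgType C) (delta : derivation D).
Hypothesis D_division : forall x : D, x != 0 -> x \is a GRing.unit.
Variable f : diffpoly delta.
Hypotheses (mon_f : dpoly f \is monic) (gt1_f : (1 < size f)%N).
Local Notation val := (@petit_val D delta f).
Local Notation mul := (@petit_mul D delta f).
Local Notation const := (@petit_const D delta f).
Local Notation one := (@petit_one D delta f).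
Local Notation T := (dvar delta).
Local Notation G := (@petit_G C D delta f).
Implicit Types x y z : petit f.

(* If x has degree k > 0, then t^(m-k) x = b f + r with b a unit and deg r < m,
   so that [t^(m-k), x, z] is -b f z modulo f: its vanishing for all z says
   that f z lies in Rf. *)
Lemma nucleus_nonconst_assoc x :
  nucleus mul x -> (1 < size (val x))%N -> associative mul.
Proof.
move=> /nucleusP Nx gt1_x; apply: petit_mulA_normal => // z.
set k := (size f - size (val x))%N.
have lt_xf := size_petit_val gt1_f x.
have nz_x : dpoly (val x) != 0 by rewrite -size_poly_gt0 ltnW.
have [sz_Tx lc_Tx] := size_lead_dvarXnM k nz_x.
rewrite subnK 1?ltnW // in sz_Tx.
have Dy : val (petit_mod f (T ^+ k)) = T ^+ k.
  apply: petit_mod_small => //.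
  have [] := @size_lead_dvarXnM D delta k 1 (oner_neq0 _).
  rewrite mulr1 => -> _; rewrite [size (1 : diffpoly delta)]size_poly1 addn1.
  by rewrite -[X in (_ < X)%N](subnK (ltnW lt_xf)) -addn1 ltn_add2l.
set b := lead_coef (val x) in lc_Tx.
have Ub : b \is a GRing.unit by rewrite D_division // lead_coef_eq0.
pose r := T ^+ k * val x - b *: f.
have DTx : T ^+ k * val x = b%:A * f + r by rewrite mulr_algl addrC subrK.
have lt_rf : (size r < size f)%N.
  rewrite -(ltn_predK gt1_f) ltnS; apply/leq_sizeP => j.
  rewrite leq_eqVlt => /predU1P[<- | lt_j].
    rewrite coefB coefZ -{1}sz_Tx -!lead_coefE lc_Tx (monicP mon_f) mulr1.
    by rewrite subrr.
  rewrite (ltn_predK gt1_f) in lt_j.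
  by rewrite coefB coefZ !nth_default ?sz_Tx // mulr0 subr0.
clearbody r; have [_ /(congr1 val) + _] := Nx (petit_mod f (T ^+ k)) z.
rewrite !petit_val_mul // Dy dmodMr // mulrA DTx dmodMDl //.
rewrite (dmod_small mon_f lt_rf) mulrDl dmodD // -mulrA.
move=> /esym/(canRL (addrK _)); rewrite subrr => bfz0.
have bVb : (b^-1)%:A * b%:A = 1 :> diffpoly delta.
  by rewrite -algM mulVr // scale1r.
by rewrite -[f * _]mul1r -bVb -mulrA -dmodMr // bfz0 mulr0 dmod0.
Qed.

Lemma petit_val_G (a : D) x : val (G a x) = (a^-1)%:A * val x * a%:A.
Proof. by rewrite petit_val_Mconst // petit_val_constM. Qed.

Lemma conj_dpolyE (a : D) (h : diffpoly delta) n :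
    a != 0 -> (size h <= n)%N ->
  (a^-1)%:A * h * a%:A =
    \sum_(i < n) conj_by a h`_i *: (T + (a^-1 * delta a)%:A) ^+ i.
Proof.
move=> /D_division Ua le_hn.
have aVa : (a%:A * (a^-1)%:A : diffpoly delta) = 1.
  by rewrite -algM divrr // scale1r.
have conjT : (a^-1)%:A * T * a%:A = T + (a^-1 * delta a)%:A.
  rewrite -mulrA dvar_comm mulrDr mulrA mulr_algl scalerA mulVr // scale1r.
  by rewrite mul1r mulr_algl scalerA.
have conjTn i : (a^-1)%:A * T ^+ i * a%:A = (T + (a^-1 * delta a)%:A) ^+ i.
  elim: i => [|i IHi]; first by rewrite !expr0 mulr1 mulr_algl scalerA mulVr // scale1r.
  rewrite [RHS]exprS -IHi -conjT exprS !mulrA.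
  by rewrite -(mulrA _ a%:A (a^-1)%:A) aVa mulr1.
rewrite [h in LHS]dpolyE mulr_sumr mulr_suml.
rewrite (big_ord_widen n (fun i => (a^-1)%:A * (h`_i *: T ^+ i) * a%:A)) //.
rewrite big_mkcond; apply: eq_bigr => i _; case: ltnP => [_ | /leq_sizeP->//].
  by rewrite -conjTn !mulr_algl scalerA -!scalerAl scalerA /conj_by mulrK.
by rewrite /conj_by mulr0 mul0r scale0r.
Qed.

Lemma petit_GE (a : D) : a != 0 ->
  G a =1 petit_H (conj_by a) (a^-1 * delta a).
Proof.
move=> nz_a x; apply: petit_val_inj.
rewrite petit_val_G /petit_H -conj_dpolyE //; last first.
  by rewrite -ltnS (ltn_predK gt1_f) size_petit_val.
rewrite petit_mod_small // (leq_ltn_trans (size_Malg _ _)) //.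
exact: leq_ltn_trans (size_algM _ _) (size_petit_val gt1_f x).
Qed.

Lemma petit_G1 : G 1 =1 id.
Proof.
move=> x; apply: petit_val_inj.
by rewrite petit_val_G invr1 scale1r mul1r mulr1.
Qed.

Lemma petit_G_comp (a b : D) : a != 0 -> b != 0 -> G a \o G b =1 G (b * a).
Proof.
move=> /D_division Ua /D_division Ub x; apply: petit_val_inj.
rewrite /= !petit_val_G invrM //.
by rewrite !algM -!mulrA.
Qed.

Lemma petit_GK (a : D) : a != 0 -> cancel (G a) (G a^-1).
Proof.
move=> nz_a x; rewrite -[LHS]/((G a^-1 \o G a) x) petit_G_comp ?invr_eq0 //.
by rewrite divrr ?petit_G1 // D_division.
Qed.

Lemma petit_GVK (a : D) : a != 0 -> cancel (G a^-1) (G a).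
Proof. by move=> nz_a; rewrite -{2}[a]invrK; apply: petit_GK; rewrite invr_eq0. Qed.

Lemma const_nuc_unit1 : const_nuc_unit f 1.
Proof.
have mul1x x : mul (const 1) x = x.
  by apply: petit_val_inj; rewrite petit_val_constM // scale1r mul1r.
have mulx1 x : mul x (const 1) = x.
  by apply: petit_val_inj; rewrite petit_val_Mconst // scale1r mulr1.
have N1 : nucleus mul (const 1).
  by apply/nucleusP => y z; rewrite !mul1x !mulx1.
split; first exact: oner_neq0.
by split=> //; exists (const 1); rewrite // petit_oneE !mul1x.
Qed.

Lemma const_nuc_unitV (a : D) : const_nuc_unit f a -> const_nuc_unit f a^-1.
Proof.
move=> [nz_a [Na [y Ny [ay1 ya1]]]]; split; first by rewrite invr_eq0.
have Dy : y = const a^-1.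
  apply: petit_val_inj; rewrite petit_val_const //.
  have /(congr1 (fun u => (a^-1)%:A * u)) : a%:A * petit_val y = 1.
    by rewrite -petit_val_constM // ay1 petit_val_one.
  by rewrite mulrA -algM mulVr ?D_division // scale1r mul1r mulr1.
by rewrite -Dy; split=> //; exists (const a).
Qed.

Lemma const_nuc_unitM (a b : D) :
  const_nuc_unit f a -> const_nuc_unit f b -> const_nuc_unit f (a * b).
Proof.
move=> Na Nb; have [_ [NVa _]] := const_nuc_unitV Na.
have [_ [NVb _]] := const_nuc_unitV Nb.
have [[nz_a [na _]] [nz_b [nb _]]] := (Na, Nb).
have [Ua Ub] := (D_division nz_a, D_division nz_b).
have Uab : a * b \is a GRing.unit by rewrite unitrMl.
split; first by apply: contraTneq Uab => ->; rewrite unitr0.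
split; first by rewrite -petit_constM //; apply: nucleusM.
exists (const (b^-1 * a^-1)); first by rewrite -petit_constM //; apply: nucleusM.
by rewrite !petit_constM // -invrM // divrr // mulVr // petit_oneE.
Qed.

Lemma petit_GM (a : D) :
  const_nuc_unit f a -> {morph G a : x y / mul x y}.
Proof.
move=> [/D_division Ua [/nucleusP Na _]] x y.
have aR u v : mul (mul u v) (const a) = mul u (mul v (const a)).
  by case: (Na u v).
rewrite /petit_G -aR petit_Aconst // -(petit_constA mon_f gt1_f a).
rewrite petit_constM // divrr // -petit_oneE.
have -> : mul one y = y.
  by apply: petit_val_inj; rewrite petit_oneE petit_val_constM // scale1r mul1r.
by congr (mul _ _); rewrite petit_constA.
Qed.

Lemma petit_aut_ext phi psi : phi =1 psi ->
  @petit_aut C D delta f psi -> petit_aut phi.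
Proof.
move=> eq_phi [bij_psi psiD psiZ psiM].
by split=> [|x y|k x Fk|x y]; rewrite ?eq_phi ?psiZ //; apply: eq_bij (fsym eq_phi).
Qed.

Lemma petit_G_aut (a : D) : const_nuc_unit f a -> petit_aut (G a).
Proof.
move=> Na; have [nz_a _] := Na; split.
- by exists (G a^-1); [apply: petit_GK | apply: petit_GVK].
- move=> x y; apply: petit_val_inj.
  by rewrite petit_valD !petit_val_G petit_valD mulrDr mulrDl.
- move=> k x /andP[/vlineP[c Dk] _]; apply: petit_val_inj.
  have aVk : a^-1 * k = k * a^-1 by rewrite Dk -scalerAr -scalerAl mulr1 mul1r.
  by rewrite petit_valZ !petit_val_G petit_valZ !mulr_algl scalerAl !scalerA aVk.
exact: petit_GM.
Qed.

Lemma inner_HP phi : @inner_H C D delta f phi <->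
  exists2 a : D, const_nuc_unit f a & phi =1 G a.
Proof.
split=> -[a Na Dphi]; exists a => // x; have [nz_a _] := Na.
  by rewrite Dphi petit_GE.
by rewrite Dphi -petit_GE.
Qed.

Lemma central_HP phi : @central_H C D delta f phi <->
  exists a : D, [/\ a \in 1%VS, const_nuc_unit f a & phi =1 G a].
Proof.
have conj1 (a : D) : a \in 1%VS -> a != 0 -> conj_by a =1 id.
  move=> /vlineP[c Da] nz_a x; have xa : x * a = a * x.
    by rewrite Da -scalerAr -scalerAl mulr1 mul1r.
  by rewrite /conj_by -mulrA xa mulKr // D_division.
have H_id a c : a \in 1%VS -> a != 0 ->
    @petit_H D delta f (conj_by a) c =1 petit_H id c.
  move=> Ca nz_a x; congr petit_mod; apply: eq_bigr => i _.
  by rewrite conj1.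
split=> [[c [a [Ca Na ->]] Dphi] | [a [Ca Na Dphi]]].
  exists a; split=> // x; have [nz_a _] := Na.
  by rewrite Dphi petit_GE // H_id.
exists (a^-1 * delta a); first by exists a.
by move=> x; have [nz_a _] := Na; rewrite Dphi petit_GE // H_id.
Qed.

Lemma petit_H_inj (c c' : D) : (2 < size f)%N ->
  @petit_H D delta f id c =1 petit_H id c' -> c = c'.
Proof.
move=> gt2_f eqH.
have HT b : val (petit_H id b (petit_mod f T)) = T + b%:A.
  rewrite /petit_H (_ : \sum_(i < _) _ = T + b%:A).
    apply: petit_mod_small => //; apply: leq_ltn_trans (size_polyD _ _) _.
    rewrite size_polyX gtn_max gt2_f.
    by apply: leq_ltn_trans (size_alg _ _) _; apply: ltnW.
  rewrite petit_mod_small /= ?size_polyX //.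
  case: (size f) gt2_f => [|[|[|n]]] //= _.
  rewrite !big_ord_recl big1 => [|i _]; last by rewrite coefX /= scale0r.
  by rewrite !coefX /= scale0r add0r addr0 scale1r expr1.
have /(congr1 val) := eqH (petit_mod f T); rewrite !HT => /addrI.
by move=> /(congr1 (@dpoly _ _)); rewrite !dpoly_alg => /polyC_inj.
Qed.

End DivisionAlgebra.

Lemma base_fieldM (C : fieldType) (D : falgType C) (a b : D) :
  a \in 1%VS -> b \in 1%VS -> a * b \in 1%VS.
Proof.
move=> /vlineP[c ->] Cb.
by rewrite -scalerAl mul1r memvZ.
Qed.

Lemma base_fieldV (C : fieldType) (D : falgType C) (a : D) :
  a \in 1%VS -> a^-1 \in 1%VS.
Proof.
move=> /vlineP[c ->]; have [-> | nz_c] := eqVneq c 0.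
  by rewrite scale0r invr0 mem0v.
by rewrite invrZ ?unitr1 ?unitfE // invr1 memvZ ?memv_line.
Qed.

Lemma size_min_poly_on_base (C : fieldType) (D : falgType C)
    (delta : derivation D) (g : {poly D}) :
    (forall x : D, x != 0 -> x \is a GRing.unit) ->
    (exists2 c : D, c \in 1%VS & c \notin base_constants delta) ->
  min_poly_on_base delta g -> (2 < size g)%N.
Proof.
move=> D_division [c Cc]; rewrite inE Cc /= => /eqP ndc [mon_g _ g0 _].
rewrite ltnNge; apply/negP => le_g2.
have evE x : der_eval delta g x = g`_0 * x + g`_1 * delta x.
  rewrite /der_eval (big_ord_widen _ (fun i => g`_i * iter i delta x) le_g2).
  rewrite big_mkcond /= 2!big_ord_recl big_ord0 addr0 /=.
  have trunc i y : (if (i < size g)%N then g`_i * y else 0) = g`_i * y.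
    by case: ltnP => // /leq_sizeP-> //; rewrite mul0r.
  by rewrite !trunc.
have g00 : g`_0 = 0.
  by have := g0 1 (memv_line 1); rewrite evE der1 mulr0 addr0 mulr1.
have U1 : g`_1 \is a GRing.unit.
  apply: D_division; apply: contraTneq mon_g => g10.
  suff -> : g = 0 by rewrite monicE lead_coef0 eq_sym oner_eq0.
  apply/polyP => -[|[|i]]; rewrite coef0 //.
  by rewrite nth_default // (leq_trans le_g2).
apply: ndc; have := g0 c Cc; rewrite evE g00 mul0r add0r.
by move=> /(congr1 (fun u => (g`_1)^-1 * u)); rewrite mulKr // mulr0.
Qed.

Theorem theorem8 (p : nat) (C : fieldType) (D : falgType C)
    (delta : derivation D) (e : nat) (a_ : nat -> D) (d : D)
    (p_char : p \in [pchar C])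
    (D_division : forall x : D, x != 0 -> x \is a GRing.unit)
    (D_central : 'Z({:D})%VS = 1%VS)
    (F_proper : exists2 c : D, c \in 1%VS & c \notin base_constants delta)
    (g_min : min_poly_on_base delta (p_poly p e a_)) :
  let f : diffpoly delta := DiffPoly delta (p_poly p e a_ - d%:P) in
  [/\ ~ associative (@petit_mul D delta f) ->
        forall x : petit f, petit_nuc_unit x ->
          exists2 a : D, a != 0 & x = petit_const f a,
      forall a : D, const_nuc_unit f a ->
        petit_aut (@petit_G C D delta f a) /\
        @petit_G C D delta f a =1 petit_H (conj_by a) (a^-1 * delta a),
      map_subgroup (@inner_H C D delta f) (@petit_aut C D delta f) /\
        (forall phi : petit f -> petit f, inner_H phi ->
           inner_map (@petit_mul D delta f) (petit_one f) phi)
    & map_subgroup (@central_H C D delta f) (@inner_H C D delta f) /\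
        (forall c c' : D, central_logder f c -> central_logder f c' ->
           @petit_H D delta f id c =1 @petit_H D delta f id c' -> c = c')].
Proof.
move=> f.
have gt2_g := size_min_poly_on_base D_division F_proper g_min.
have [mon_g _ _ _] := g_min.
have lt_dg : (size (- d%:P)%R < size (p_poly p e a_))%N.
  by rewrite size_polyN (leq_ltn_trans (size_polyC_leq1 _)) // ltnW.
have gt2_f : (2 < size f)%N by rewrite size_polyDl.
have gt1_f := ltnW gt2_f.
have mon_f : dpoly f \is monic by rewrite monicE lead_coefDl // -monicE.
have innerP := inner_HP D_division mon_f gt1_f.
have centralP := central_HP D_division mon_f gt1_f.
have autG a := petit_G_aut D_division mon_f gt1_f (a := a).
have nuc1 := const_nuc_unit1 mon_f gt1_f.
have nucV a := const_nuc_unitV D_division mon_f gt1_f (a := a).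
have nucM a b := const_nuc_unitM D_division mon_f gt1_f (a := a) (b := b).
have G1 := petit_G1 mon_f gt1_f.
have Gcomp := petit_G_comp D_division mon_f gt1_f.
have GK := petit_GK D_division mon_f gt1_f.
have GVK := petit_GVK D_division mon_f gt1_f.
split.
- move=> nassoc x [Nx [y _ [xy1 _]]].
  have le_x1 : (size (petit_val x) <= 1)%N.
    rewrite leqNgt; apply/negP => /(nucleus_nonconst_assoc D_division mon_f gt1_f Nx).
    exact: nassoc.
  have Dx : x = petit_const f (petit_val x)`_0.
    apply: petit_val_inj; apply: dpoly_inj; rewrite petit_val_const // dpoly_alg.
    exact: size1_polyC.
  exists (petit_val x)`_0 => //; apply/eqP => x0.
  have /eqP[] := oner_neq0 (diffpoly delta).
  rewrite -(petit_val_one mon_f gt1_f) -xy1 Dx x0 petit_val_constM //.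
  by rewrite scale0r mul0r.
- move=> a Na; have [nz_a _] := Na.
  by split; [apply: autG | apply: petit_GE].
- split; last first.
    move=> phi /innerP[a Na Dphi]; have [nz_a _] := Na.
    exists (petit_const f a), (petit_const f a^-1); split=> //.
    by rewrite petit_constM // mulVr ?petit_oneE // D_division.
  split.
  + by move=> phi /innerP[a Na Dphi]; apply: petit_aut_ext Dphi (autG a Na).
  + by apply/innerP; exists 1 => // x; rewrite G1.
  + move=> phi psi /innerP[a Na Dphi] /innerP[b Nb Dpsi]; apply/innerP.
    have [[nz_a _] [nz_b _]] := (Na, Nb).
    by exists (b * a) => [|x]; [apply: nucM | rewrite -Gcomp //= Dphi Dpsi].
  move=> phi /innerP[a Na Dphi]; have [nz_a _] := Na.
  exists (petit_G a^-1); first by apply/innerP; exists a^-1 => //; apply: nucV.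
  by split=> x; rewrite Dphi ?GK ?GVK.
split; last by move=> c c' _ _; apply: petit_H_inj.
split.
+ by move=> phi /centralP[a [_ Na Dphi]]; apply/innerP; exists a.
+ by apply/centralP; exists 1; split=> [||x]; rewrite ?memv_line ?G1.
+ move=> phi psi /centralP[a [Ca Na Dphi]] /centralP[b [Cb Nb Dpsi]].
  have [[nz_a _] [nz_b _]] := (Na, Nb).
  apply/centralP; exists (b * a); split=> [||x]; first exact: base_fieldM.
    exact: nucM.
  by rewrite -Gcomp //= Dphi Dpsi.
move=> phi /centralP[a [Ca Na Dphi]]; have [nz_a _] := Na.
exists (petit_G a^-1).
  by apply/centralP; exists a^-1; split=> //; [apply: base_fieldV | apply: nucV].
by split=> x; rewrite Dphi ?GK ?GVK.
Qed.
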